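(* Let $M$ be a complete finite-dimensional Riemannian manifold, let $W$ be a $C^2$ codimension-1 submanifold of $M$, and let $N_xW$ denote the normal space of $W$ at $x\in W$ (the fibre at $x$ of the normal bundle of $W$). Then $N^P_W(x)=N_xW$ for every $x\in W$.
   Context: Submanifold means embedded submanifold. For $S\subseteq M$ and $x\in S$, the proximal normal cone is $$N^P_S(x)=\{v\in T_xM : \text{there is } \sigma\ge 0 \text{ with } \langle v,\exp_x^{-1}y\rangle\le \sigma\|\exp_x^{-1}y\|^2 \text{ for all } y\in U\cap S\},$$ where $U$ is a normal neighborhood of $x$ in $M$ (the cone does not depend on the choice of $U$). The paper introduces this cone for closed $S$; here the same formula is used with $S=W$. *)

(* Defs.v *)
From mathcomp Require Import all_boot all_order all_algebra.
From mathcomp Require Import all_classical all_reals all_analysis.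
Set Implicit Arguments.
Unset Strict Implicit.
Unset Printing Implicit Defensive.
Import Order.TTheory GRing.Theory Num.Theory.
Import numFieldNormedType.Exports.
Local Open Scope classical_set_scope.
Local Open Scope ring_scope.

(** * Maps of class C^k *)

(* Meant for open sets A of finite-dimensional spaces: the derivatives are
   two-sided, so the values of f near a point of A matter. *)
Fixpoint Ck (R : realType) (V W : normedModType R) (k : nat) (A : set V)
    (f : V -> W) : Prop :=
  if k is j.+1 then
    (forall x, A x -> differentiable f x) /\
    (forall v : V, Ck j A (fun x => 'D_v f x))
  else forall x, A x -> {for x, continuous f}.

Definition smooth (R : realType) (V W : normedModType R) (A : set V)
    (f : V -> W) : Prop := forall k, Ck k A f.

(** * Riemannian manifolds *)

(* [phi] and [psi] are total functions; only their restrictions to [dom] and to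
   [phi @` dom] are meaningful. *)
Record chart (R : realType) (n : nat) (M : topologicalType) := Chart {
  dom : set M;
  phi : M -> 'rV[R]_n;
  psi : 'rV[R]_n -> M;
  dom_open : open dom;
  cod_open : open (phi @` dom);
  phi_continuous : forall x, dom x -> {for x, continuous phi};
  psi_continuous : forall y, (phi @` dom) y -> {for y, continuous psi};
  psiK : forall x, dom x -> psi (phi x) = x }.

Definition compatible (R : realType) (n : nat) (M : topologicalType) (r : nat)
    (c d : chart R n M) : Prop :=
  Ck r (phi c @` (dom c `&` dom d)) (phi d \o psi c) /\
  Ck r (phi d @` (dom c `&` dom d)) (phi c \o psi d).

(* The metric is given by its Gram matrices in the charts of the atlas, subject
   to the transformation law [gram_change] of a covariant 2-tensor.
   [chart_at x] is an arbitrary chart of the atlas around x, used only to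
   represent tangent vectors at x by their coordinates; see [tangent]. *)
Record riemannianManifold (R : realType) (n : nat) := RiemannianManifold {
  carrier :> topologicalType;
  manifold_hausdorff : hausdorff_space carrier;
  manifold_second_countable : @second_countable carrier;
  atlas : set (chart R n carrier);
  chart_at : carrier -> chart R n carrier;
  atlas_chart_at : forall x, atlas (chart_at x);
  dom_chart_at : forall x, dom (chart_at x) x;
  atlas_compatible : forall c d, atlas c -> atlas d ->
    forall r, compatible r c d;
  gram : chart R n carrier -> 'rV[R]_n -> 'M[R]_n;
  gram_smooth : forall c, atlas c -> forall i j,
    smooth (phi c @` dom c) (fun y => gram c y i j);
  gram_sym : forall c y, atlas c -> (phi c @` dom c) y ->
    (gram c y)^T = gram c y;
  gram_pos : forall c y (v : 'rV[R]_n), atlas c -> (phi c @` dom c) y ->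
    v != 0 -> 0 < (v *m gram c y *m v^T) 0 0;
  gram_change : forall c d x (v w : 'rV[R]_n), atlas c -> atlas d ->
    dom c x -> dom d x ->
    (v *m gram c (phi c x) *m w^T) 0 0 =
    ('D_v (phi d \o psi c) (phi c x) *m gram d (phi d x) *m
     ('D_w (phi d \o psi c) (phi c x))^T) 0 0 }.

(* T_x M: a tangent vector is represented by its coordinates in [chart_at x]. *)
Definition tangent (R : realType) (n : nat) (M : riemannianManifold R n)
  (x : M) : normedModType R := 'rV[R]_n.

Section RiemannianGeometry.
Context {R : realType} {n : nat} {M : riemannianManifold R n}.
Implicit Types (x y : M) (S W U : set M) (g : R -> M).

Definition inner x (v w : tangent x) : R :=
  ((v : 'rV[R]_n) *m gram (chart_at x) (phi (chart_at x) x) *m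
   (w : 'rV[R]_n)^T) 0 0.

Definition tnorm x (v : tangent x) : R := Num.sqrt (inner v v).

(* The velocity at time t of a curve which passes through x at time t. *)
Definition velocity x g (t : R) : tangent x :=
  derive1 (phi (chart_at x) \o g) t.
Arguments velocity : clear implicits.

(** ** Geodesics and the exponential map *)

Definition pgram (c : chart R n M) (y : 'rV[R]_n) (l i j : 'I_n) : R :=
  'D_(delta_mx 0 l) (fun z => gram c z i j) y.

(* The Christoffel symbol of the second kind, with upper index k. *)
Definition christoffel (c : chart R n M) (y : 'rV[R]_n) (k i j : 'I_n) : R :=
  2^-1 * \sum_l invmx (gram c y) k l *
    (pgram c y i j l + pgram c y j i l - pgram c y l i j).

Definition geodesic g : Prop :=
  continuous g /\
  forall c t, atlas c -> dom c (g t) ->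
    let u := phi c \o g in
    [/\ \forall s \near t, derivable u s 1,
        derivable (derive1 u) t 1 &
        forall k, derive1 (derive1 u) t 0 k +
          \sum_i \sum_j
            christoffel c (u t) k i j * derive1 u t 0 i * derive1 u t 0 j = 0].

Definition geodesic_from x (v : tangent x) g : Prop :=
  [/\ geodesic g, g 0 = x & velocity x g 0 = v].
Arguments geodesic_from : clear implicits.

(* By uniqueness of geodesics there is at most one candidate value; the default
   value x is used only if the geodesic does not extend to the whole line. *)
Definition exp_map x (v : tangent x) : M :=
  xget x [set y | exists2 g, geodesic_from x v g & y = g 1].
Arguments exp_map : clear implicits.

Definition exp_inv x (V : set (tangent x)) y : tangent x :=
  xget 0 [set w | V w /\ exp_map x w = y].
Arguments exp_inv : clear implicits.

(* exp_x is a smooth diffeomorphism from the open set V, which contains 0, onto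
   the open set U. *)
Definition normal_neighborhood x (V : set (tangent x)) U : Prop :=
  [/\ open V, V 0, open U & set_bij V U (exp_map x)] /\
  [/\ forall w, V w -> {for w, continuous (exp_map x)},
      forall c, atlas c ->
        smooth (V `&` exp_map x @^-1` dom c) (phi c \o exp_map x) &
      forall c, atlas c ->
        smooth (phi c @` (U `&` dom c)) (exp_inv x V \o psi c)].

(** ** Submanifolds, normal spaces and proximal normal cones *)

(* W is an embedded submanifold of class C^r and codimension k. *)
Definition submanifold (r k : nat) W : Prop :=
  forall x, W x -> exists d : chart R n M,
    [/\ dom d x, (forall c, atlas c -> compatible r c d), (k <= n)%N &
        forall y, dom d y ->
          (W y <-> forall i : 'I_n, (i < k)%N -> phi d y 0 i = 0)].

(* The velocities at x of the C^1 curves in W through x. *)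
Definition tangent_space_of W x : set (tangent x) :=
  [set v | exists g, exists2 e : R, 0 < e &
    [/\ g 0 = x,
        forall t, ball (0 : R) e t -> W (g t) /\ dom (chart_at x) (g t),
        Ck 1 (ball (0 : R) e) (phi (chart_at x) \o g) &
        velocity x g 0 = v]].
Arguments tangent_space_of : clear implicits.

Definition normal_space_of W x : set (tangent x) :=
  [set v | forall w, tangent_space_of W x w -> inner v w = 0].

(* The cone computed in the normal neighborhood U = exp_x(V), on which the
   inverse of exp_x takes its values in V. *)
Definition proximal_normal_cone S x (V : set (tangent x)) U :
    set (tangent x) :=
  [set v | exists2 sigma : R, 0 <= sigma &
    forall y, U y -> S y ->
      inner v (exp_inv x V y) <= sigma * tnorm (exp_inv x V y) ^+ 2].

End RiemannianGeometry.

Arguments velocity {R n M} x g t.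
Arguments geodesic_from {R n M} x v g.
Arguments exp_map {R n M} x v.
Arguments exp_inv {R n M} x V y.
Arguments normal_neighborhood {R n M} x V U.
Arguments tangent_space_of {R n M} W x _.
Arguments normal_space_of {R n M} W x _.
Arguments proximal_normal_cone {R n M} S x V U _.

(* That is, exp_x is defined on all of T_x M. *)
Definition geodesically_complete (R : realType) (n : nat)
    (M : riemannianManifold R n) : Prop :=
  forall (x : M) (v : tangent x), exists g, geodesic_from x v g.

(* Main.v *)
Require Import Defs.
From mathcomp Require Import all_boot all_order all_algebra.
From mathcomp Require Import all_classical all_reals all_analysis.
From mathcomp Require Import ring lra.
Import Order.TTheory GRing.Theory Num.Theory.
Import numFieldNormedType.Exports.
Local Open Scope classical_set_scope.
Local Open Scope ring_scope.

(** Work in the chart c = [chart_at x] with p = phi c x. The only information on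
    the exponential map that is needed is the expansion

      phi c (exp_x w) = p + w + O(|w|^2)                ([exp_map_expansion]).

    It follows from an a priori estimate on the geodesic equation, which says
    u'' = - Gamma(u', u') in the chart: if |u'(0)| <= eps, then a continuation
    argument in time keeps u near p and |u'| <= 2 eps on [0, 1], so u'' is
    O(eps^2) there, whence u(1) = p + u'(0) + O(eps^2) ([short_geodesic]). This
    holds for every geodesic with the given initial velocity, hence for the one
    that defines exp_x w, and exp_x 0 = x is the case w = 0.

    Normal vectors are proximal ([normal_sub_proximal]). Near x, W is the zero
    set of h = (phi d)_0, a C^2 function of the coordinates in c. Every vector in
    the kernel of Dh(p) is the velocity of a curve in W, obtained by pulling back
    a straight line from the chart d, so a normal vector v satisfies
    <v, .> = lam Dh(p). If y = exp_x w is in W, then Taylor's formula for h and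
    the expansion of exp_x give |Dh(p) w| = O(|w|^2), hence
    <v, w> <= sigma |w|^2 for small w. For w away from 0 this inequality is the
    boundedness of <v, .>.

    Proximal vectors are normal ([proximal_sub_normal]). Along a C^1 curve g in W
    with g(0) = x and velocity w, the expansion of exp_x can be inverted because
    exp_x^{-1} is continuous at x: exp_x^{-1}(g(t)) = t w + o(t). The proximal
    inequality becomes t <v, w> + o(t) <= O(t^2), for both signs of t, so that
    <v, w> = 0. *)

(** * Differential calculus in normed spaces *)

Lemma coord_le_norm {R : realType} {m n : nat} (A : 'M[R]_(m, n)) i j :
  `|A i j| <= `|A|.
Proof.
rewrite [leRHS]/Num.Def.normr/= mx_normrE.
exact: (le_bigmax _ (fun ij => `|A ij.1 ij.2|) (i, j)).
Qed.

Lemma norm_le_coord {R : realType} {n : nat} (v : 'rV[R]_n) (L : R) :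
  0 <= L -> (forall j, `|v 0 j| <= L) -> `|v| <= L.
Proof.
move=> L0 vL; rewrite [leLHS]/Num.Def.normr/= mx_normrE bigmax_le//= => -[i j] _ /=.
by rewrite (ord1 i).
Qed.

Lemma derive1_coord {R : realType} {n : nat} (u : R -> 'rV[R]_n) t j :
  derivable u t 1 -> is_derive t 1 (fun s => u s 0 j) (derive1 u t 0 j).
Proof.
move=> du; apply: DeriveDef; first by move/derivable_mxP: du; exact.
by rewrite derive1E derive_mx// mxE.
Qed.

(** Subtracting [s *: a] makes one statement serve both for velocities (a = 0)
    and for positions compared with uniform motion (a = u'(0)). The norm on row
    vectors is the maximum norm, so the scalar mean value theorem applies to each
    coordinate without loss in the constant. *)
Lemma mean_value_le {R : realType} {n : nat} (u : R -> 'rV[R]_n)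
    (a : 'rV[R]_n) (L s : R) : 0 <= s ->
  (forall t : R, 0 <= t <= s -> derivable u t 1 /\ `|derive1 u t - a| <= L) ->
  `|u s - u 0 - s *: a| <= L * s.
Proof.
move=> s0 H.
have L0 : 0 <= L.
  by have [|_] := H 0; rewrite ?lexx// => /(le_trans _); apply.
apply: norm_le_coord => [|j]; first exact: mulr_ge0.
have [t tI ut] : exists2 t, t \in `[0, s] &
    u s 0 j - u 0 0 j = derive1 u t 0 j * (s - 0).
  apply: (@MVT_segment _ (fun t => u t 0 j) (fun t => derive1 u t 0 j)) => //.
    move=> t; rewrite in_itv/= => /andP[t0 ts].
    by apply: derive1_coord; have [|//] := H t; rewrite !ltW.
  apply: derivable_within_continuous => t; rewrite in_itv/= => tI.
  by have [/(derive1_coord _ _ j)[]] := H t tI.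
move: tI; rewrite in_itv/= => tI; have [_ HL] := H t tI.
have -> : (u s - u 0 - s *: a) 0 j = (derive1 u t - a) 0 j * s.
  by rewrite !mxE ut subr0; ring.
rewrite normrM (ger0_norm s0); apply: ler_wpM2r => //.
exact: le_trans (coord_le_norm _ _ _) HL.
Qed.

Lemma differentiable_first_order {R : realType} {V W : normedModType R}
    (f : V -> W) (p : V) (eta : R) : differentiable f p -> 0 < eta ->
  \forall w \near (0 : V), `|f (p + w) - f p - 'd f p w| <= eta * `|w|.
Proof.
move=> df eta0; have /diff_locally := df; set o := 'o _ => E.
have /(littleoP [littleo of o]) := eta0.
apply: filterS => w /= ow.
have -> : f (p + w) = (f \o shift p) w by rewrite /= addrC.
rewrite E /=.
have -> : (cst (f p) + 'd f p + o) w = f p + ('d f p w + o w) by rewrite addrA.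
by rewrite [_ - f p]addrC addKr [_ - 'd f p w]addrC addKr.
Qed.

Lemma differentiable_lipschitz_at {R : realType} {V W : normedModType R}
    (f : V -> W) (p : V) : differentiable f p ->
  exists2 C : R, 0 <= C & \forall w \near (0 : V), `|f (p + w) - f p| <= C * `|w|.
Proof.
move=> df; have [k k0 kP] := linear_lipschitz (diff_continuous df).
exists (k + 1); first lra.
apply: filterS (differentiable_first_order _ _ _ df ltr01) => w fw.
rewrite -[f (p + w) - f p](subrK ('d f p w)) (le_trans (ler_normD _ _))//.
by rewrite mulrDl addrC lerD.
Qed.

Lemma near_translate {R : realType} {V : normedModType R} (p : V) (A : set V) :
  nbhs p A -> \forall w \near (0 : V), A (p + w).
Proof.
move=> /nbhs_ballP[r /= r0 rA]; apply/nbhs_ballP; exists r => //= w.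
rewrite -ball_normE/= sub0r normrN => wr; apply: rA.
by rewrite -ball_normE/= opprD addrA subrr sub0r normrN.
Qed.

(** The two difference quotients are the same function of the increment, so this
    holds for a derivative in the single direction w. *)
Lemma is_derive_line {R : realType} {V W : normedModType R} (f : V -> W)
    (p w : V) (t : R) : derivable f (p + t *: w) w ->
  is_derive t 1 (fun s => f (p + s *: w)) ('D_w f (p + t *: w)).
Proof.
move=> df.
have E : (fun h : R => h^-1 *: (f (p + (h *: 1 + t) *: w) - f (p + t *: w))) =
    (fun h : R => h^-1 *: (f (h *: w + (p + t *: w)) - f (p + t *: w))).
  apply/funext => h; congr (_ *: (f _ - _)).
  by rewrite scalerDl [h *: 1]mulr1 addrCA.
by apply: DeriveDef; rewrite /derivable/= /derive/= E.
Qed.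

(** On the segment from p to p + w the velocity of t |-> f (p + t w) is
    'D_w f (p + t w), the sum of the w_j 'D_{e_j} f. Each partial derivative is
    differentiable at p, hence moves by O(|w|), and each w_j is O(|w|). *)
Lemma taylor2 {R : realType} {m n : nat} (f : 'rV[R]_m -> 'rV[R]_n)
    (A : set 'rV[R]_m) (p : 'rV[R]_m) : nbhs p A -> Ck 2 A f ->
  exists2 C : R, 0 <= C &
    \forall w \near (0 : 'rV[R]_m), `|f (p + w) - f p - 'D_w f p| <= C * `|w| ^+ 2.
Proof.
move=> pA [df d2f]; have Ap := nbhs_singleton pA.
have DE v y : A y -> 'D_v f y = \sum_j v 0 j *: 'D_(delta_mx 0 j) f y.
  move=> /df dfy; rewrite deriveE// {1}(row_sum_delta v) linear_sum.
  by apply: eq_bigr => j _; rewrite linearZ deriveE.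
have /choice[C CP] (j : 'I_m) : exists C : R, 0 <= C /\ \forall w \near (0 : 'rV[R]_m),
    `|'D_(delta_mx 0 j) f (p + w) - 'D_(delta_mx 0 j) f p| <= C * `|w|.
  have [dd _] := d2f (delta_mx 0 j).
  by have [C C0 CP] := differentiable_lipschitz_at _ _ (dd p Ap); exists C.
exists (\sum_j C j); first by apply: sumr_ge0 => j _; have [] := CP j.
have nA : \forall w \near (0 : 'rV[R]_m), A (p + w).
  exact: near_translate.
have nC : \forall w \near (0 : 'rV[R]_m), forall j,
    `|'D_(delta_mx 0 j) f (p + w) - 'D_(delta_mx 0 j) f p| <= C j * `|w|.
  have := @filter_forall _ _ (fun (j : 'I_m) w =>
    `|'D_(delta_mx 0 j) f (p + w) - 'D_(delta_mx 0 j) f p| <= C j * `|w|)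
    (nbhs (0 : 'rV[R]_m)) (nbhs_filter _).
  by apply=> j; have [] := CP j.
have [r /= r0 rP] := (nbhs_ballP _ _).1 (filterI nA nC).
apply/nbhs_ballP; exists r => //= w wr.
pose u (t : R) := f (p + t *: w).
have tw t : 0 <= t <= 1 -> ball (0 : 'rV[R]_m) r (t *: w).
  move=> /andP[t0 t1]; move: wr; rewrite -!ball_normE/= !sub0r !normrN normrZ.
  by apply: le_lt_trans; rewrite ger0_norm// ler_piMl.
have := mean_value_le u ('D_w f p) ((\sum_j C j) * `|w| ^+ 2) 1 ler01.
rewrite mulr1 /u scale1r scale0r addr0 scale1r; apply => t t01.
have [At Ct] := rP _ (tw _ t01).
have cE : is_derive t 1 u ('D_w f (p + t *: w)).
  by apply: is_derive_line; apply: diff_derivable; exact: df.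
split; first exact: ex_derive.
rewrite derive1E derive_val (DE _ _ At) (DE _ _ Ap) -sumrB.
apply: (le_trans (ler_norm_sum _ _ _)); rewrite mulr_suml ler_sum// => j _.
rewrite -scalerBr normrZ.
have := Ct j; have := coord_le_norm w 0 j; have [C0 _] := CP j.
rewrite normrZ; case/andP: t01 => t0 t1; rewrite (ger0_norm t0) => wj H.
rewrite [leRHS](_ : _ = `|w| * (C j * `|w|)); last by ring.
apply: ler_pM => //; apply: (le_trans H); apply: ler_wpM2l => //.
by rewrite ler_piMl.
Qed.

Lemma continuous_near_dist {R : realType} {V W : normedModType R} (f : V -> W)
    (p : V) (e : R) : {for p, continuous f} -> 0 < e ->
  \forall y \near p, `|f p - f y| <= e.
Proof. by move=> /cvgrPdist_le h /h. Qed.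

(** If P failed somewhere in [0, T], look at the infimum b of the set of failures:
    P holds before b, hence at b by closedness, hence a little beyond b by
    openness. *)
Lemma real_induction {R : realType} (T : R) (P : R -> Prop) :
  P 0 ->
  (forall s : R, 0 <= s <= T -> (forall t : R, 0 <= t <= s -> P t) ->
    \forall t \near s, P t) ->
  (forall s : R, 0 < s <= T -> (forall t : R, 0 <= t < s -> P t) -> P s) ->
  forall s : R, 0 <= s <= T -> P s.
Proof.
move=> P0 Popen Pclosed s /andP[s0 sT]; apply: contrapT => nPs.
pose B := [set t : R | 0 <= t /\ ~ P t].
have Bs : B s by [].
have infB : has_inf B by split; [exists s|exists 0 => t []].
have b0 : 0 <= inf B by apply: lb_le_inf; [exists s|move=> t []].
have bT : inf B <= T by apply: le_trans sT; apply: ge_inf => //; case: infB.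
have Plt t : 0 <= t < inf B -> P t.
  move=> /andP[t0 tb]; apply: contrapT => nPt.
  suff : inf B <= t by rewrite leNgt tb.
  by apply: ge_inf; [case: infB|].
have Ple t : 0 <= t <= inf B -> P t.
  rewrite [t <= _]le_eqVlt => /andP[t0 /orP[/eqP tb|tb]]; last by apply: Plt; rewrite t0.
  have [->//|tn0] := eqVneq t 0.
  by apply: Pclosed; [rewrite lt_def tn0 t0 tb bT|rewrite tb].
have bI : 0 <= inf B <= T by rewrite b0.
have [r /= r0 rP] := (nbhs_ballP _ _).1 (Popen _ bI Ple).
have [t [t0 nPt] tr] := inf_adherent r0 infB.
have bt : inf B <= t by apply: ge_inf => //; case: infB.
apply: nPt; apply: rP; rewrite /ball/= ltr_norml.
by move: tr bt; lra.
Qed.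

Lemma near_left_witness {R : realType} (s : R) (Q : set R) :
  0 < s -> nbhs s Q -> exists2 t : R, 0 <= t < s & Q t.
Proof.
move=> s0 /nbhs_ballP[r /= r0 rQ]; exists (Num.max 0 (s - r / 2)).
  by rewrite le_max lexx gt_max s0/=; lra.
apply: rQ; rewrite /ball/= ltr_norml.
by have [h|h] := leP 0 (s - r / 2); lra.
Qed.

(** * Continuity of matrix inversion, positive definite forms *)

Lemma cvg_mul_pt {R : realType} {T : Type} (F : set_system T) {FF : Filter F}
    (f g : T -> R) (a b : R) : f x @[x --> F] --> a -> g x @[x --> F] --> b ->
  f x * g x @[x --> F] --> a * b.
Proof. by move=> fa gb; exact: (cvgM fa gb). Qed.

Lemma cvg_sum_ord {R : realType} {T : Type} (F : set_system T) {FF : Filter F}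
    (I : finType) (f : I -> T -> R) (a : I -> R) :
  (forall i, f i x @[x --> F] --> a i) ->
  \sum_i f i x @[x --> F] --> \sum_i a i.
Proof.
move=> fa; apply: (cvg_big (op := +%R)) => //.
exact: add_continuous.
Qed.

Lemma cvg_prod_ord {R : realType} {T : Type} (F : set_system T) {FF : Filter F}
    (I : finType) (f : I -> T -> R) (a : I -> R) :
  (forall i, f i x @[x --> F] --> a i) ->
  \prod_i f i x @[x --> F] --> \prod_i a i.
Proof.
move=> fa; apply: (@cvg_big R _ (@GRing.mul R)) => //.
exact: mul_continuous.
Qed.

Lemma cvg_det {R : realType} {T : Type} (F : set_system T) {FF : Filter F} {n : nat}
    (M : T -> 'M[R]_n) (A : 'M[R]_n) :
  (forall i j, M x i j @[x --> F] --> A i j) -> \det (M x) @[x --> F] --> \det A.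
Proof.
move=> MA; apply: cvg_sum_ord => s; apply: cvg_mul_pt; first exact: cvg_cst.
exact: cvg_prod_ord.
Qed.

(** Cramer's rule: near the limit the determinant does not vanish, and the entries
    of the inverse are quotients of polynomials in the entries. *)
Lemma cvg_invmx {R : realType} {T : Type} (F : set_system T) {FF : Filter F} {n : nat}
    (M : T -> 'M[R]_n) (A : 'M[R]_n) : A \in unitmx ->
  (forall i j, M x i j @[x --> F] --> A i j) ->
  forall i j, invmx (M x) i j @[x --> F] --> invmx A i j.
Proof.
move=> uA MA i j.
have dA : \det A != 0 by rewrite -unitfE -unitmxE.
have cdet : \det (M x) @[x --> F] --> \det A by exact: cvg_det.
have nz : \forall x \near F, \det (M x) != 0.
  exact: cvgr_neq0 cdet dA.
have E (B : 'M[R]_n) : B \in unitmx -> invmx B i j = (\det B)^-1 * cofactor B j i.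
  by move=> uB; rewrite /invmx uB !mxE.
rewrite (E _ uA).
apply: cvg_trans; first apply: (@near_eq_cvg _ _ F FF
    (fun x => (\det (M x))^-1 * cofactor (M x) j i) (fun x => invmx (M x) i j)).
  by apply: filterS nz => x nx; rewrite E// unitmxE unitfE.
apply: cvg_mul_pt; first exact: cvgV.
rewrite /cofactor; apply: cvg_mul_pt; first exact: cvg_cst.
apply: cvg_det => k l.
have E' (B : 'M[R]_n) : (row' j (col' i B)) k l = B (lift j k) (lift i l) by rewrite !mxE.
rewrite E'.
rewrite (_ : (fun x => row' j (col' i (M x)) k l) = (fun x => M x (lift j k) (lift i l))) //.
by apply/funext => x; exact: E'.
Qed.

Lemma form_bound {R : realType} {n : nat} (G : 'M[R]_n) :
  exists2 B : R, 0 <= B &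
    forall v w : 'rV[R]_n, `|(v *m G *m w^T) 0 0| <= B * `|v| * `|w|.
Proof.
exists (\sum_j \sum_i `|G i j|).
  by apply: sumr_ge0 => j _; apply: sumr_ge0.
move=> v w; rewrite mxE -mulrA mulr_suml; apply: (le_trans (ler_norm_sum _ _ _)).
apply: ler_sum => j _; rewrite mxE normrM mxE mulrA; apply: ler_pM => //; last first.
  exact: coord_le_norm.
rewrite mulr_suml; apply: (le_trans (ler_norm_sum _ _ _)).
by apply: ler_sum => i _; rewrite normrM mulrC ler_wpM2l// coord_le_norm.
Qed.

Section form.
Context {R : realType} {n : nat} (G : 'M[R]_n).
Context (Gsym : G^T = G).
Context (Gpos : forall v : 'rV[R]_n, v != 0 -> 0 < (v *m G *m v^T) 0 0).
Let form (v w : 'rV[R]_n) : R := (v *m G *m w^T) 0 0.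

Lemma posdef_unitmx : G \in unitmx.
Proof.
rewrite unitmxE unitfE; apply/negP => /eqP/eqP/det0P[v v0 vG].
by have := Gpos _ v0; rewrite vG mul0mx mxE ltxx.
Qed.

Lemma form_sym v w : form v w = form w v.
Proof.
rewrite /form -[in LHS](trmxK (v *m G *m w^T)) [in LHS]mxE.
by rewrite !trmx_mul trmxK Gsym mulmxA.
Qed.

Lemma cauchy_schwarz v w : form v w ^+ 2 <= form v v * form w w.
Proof.
have [->|v0] := eqVneq v 0; first by rewrite /form !mul0mx mxE expr0n mul0r.
have fv := Gpos _ v0; rewrite -/(form v v) in fv.
have fge0 (u : 'rV[R]_n) : 0 <= form u u.
  have [->|u0] := eqVneq u 0; first by rewrite /form !mul0mx mxE.
  exact/ltW/Gpos.
(* Up to the factor form v v, this is w minus its projection on v. *)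
have := fge0 (form v v *: w - form v w *: v).
have -> : form (form v v *: w - form v w *: v) (form v v *: w - form v w *: v) =
   form v v * (form v v * form w w - form v w ^+ 2).
  have DL a b c : form (a - b) c = form a c - form b c.
    by rewrite /form !mulmxBl !mxE.
  have DR a b c : form a (b - c) = form a b - form a c.
    by rewrite !(form_sym a) DL.
  have ZL k a b : form (k *: a) b = k * form a b.
    by rewrite /form -!scalemxAl !mxE.
  have ZR k a b : form a (k *: b) = k * form a b by rewrite !(form_sym a) ZL.
  rewrite !(DL, DR, ZL, ZR) (form_sym w v); ring.
by rewrite pmulr_rge0// subr_ge0.
Qed.

(** The j-th coordinate of w is the value of the form at (e_j G^-1, w), so it is
    controlled by Cauchy-Schwarz. *)
Lemma posdef_norm_le : exists2 C : R, 0 < C & forall w : 'rV[R]_n, `|w| ^+ 2 <= C * form w w.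
Proof.
pose a (j : 'I_n) : 'rV[R]_n := delta_mx 0 j *m invmx G.
have fge0 (u : 'rV[R]_n) : 0 <= form u u.
  have [->|u0] := eqVneq u 0; first by rewrite /form !mul0mx mxE.
  exact/ltW/Gpos.
have S0 : 0 <= \sum_j form (a j) (a j) by apply: sumr_ge0.
exists (1 + \sum_j form (a j) (a j)); first lra.
move=> w.
have wj j : w 0 j = form (a j) w.
  by rewrite /form /a mulmxKV ?posdef_unitmx// -rowE !mxE.
have rhs0 : 0 <= (1 + \sum_j form (a j) (a j)) * form w w.
  by apply: mulr_ge0 => //; lra.
rewrite -(sqr_sqrtr rhs0) ler_pXn2r ?nnegrE// ?sqrtr_ge0//.
apply: norm_le_coord => [|j]; first exact: sqrtr_ge0.
rewrite -sqrtr_sqr ler_wsqrtr// wj (le_trans (cauchy_schwarz _ _))//.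
apply: ler_wpM2r => //; rewrite (bigD1 j)//= addrCA lerDl addr_ge0// sumr_ge0//.
Qed.

End form.

(** * Short geodesics and the first-order expansion of exp *)

(** The Christoffel symbols are continuous, being made of the inverse Gram matrix
    and the first derivatives of the metric. *)
Lemma christoffel_locally_bounded {R : realType} {n : nat} {M : riemannianManifold R n}
    (c : chart R n M) (p : 'rV[R]_n) : atlas c -> (phi c @` dom c) p ->
  exists2 K : R, 0 <= K & \forall y \near p, forall k (a : 'rV[R]_n),
    `|\sum_i \sum_j christoffel c y k i j * a 0 i * a 0 j| <= K * `|a| ^+ 2.
Proof.
move=> ac cp; have FF : Filter (nbhs p) := nbhs_filter p.
have cgram i j : gram c y i j @[y --> p] --> gram c p i j.
  exact: (gram_smooth ac i j 0).
have cpgram l i j : pgram c y l i j @[y --> p] --> pgram c p l i j.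
  by have [_ /(_ (delta_mx 0 l) p cp)] := gram_smooth ac i j 1.
have uG : gram c p \in unitmx.
  by apply: posdef_unitmx => v; apply: gram_pos.
have cchr k i j : christoffel c y k i j @[y --> p] --> christoffel c p k i j.
  apply: cvg_mul_pt; first exact: cvg_cst.
  apply: cvg_sum_ord => l; apply: cvg_mul_pt; first exact: cvg_invmx.
  exact: (cvgB (cvgD (cpgram i j l) (cpgram j i l)) (cpgram l i j)).
pose B k i j := `|christoffel c p k i j| + 1.
have B0 k i j : 0 <= B k i j by rewrite addr_ge0.
exists (\sum_k \sum_i \sum_j B k i j).
  by do 3!(apply: sumr_ge0 => ? _).
have nB : \forall y \near p, forall kij : 'I_n * 'I_n * 'I_n,
    `|christoffel c y kij.1.1 kij.1.2 kij.2| <= B kij.1.1 kij.1.2 kij.2.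
  apply: (@filter_forall _ _ (fun (kij : 'I_n * 'I_n * 'I_n) y =>
    `|christoffel c y kij.1.1 kij.1.2 kij.2| <= B kij.1.1 kij.1.2 kij.2) (nbhs p)).
  move=> [[k i] j] /=; have /cvgrPdist_le/(_ _ ltr01) := cchr k i j.
  apply: filterS => y /= h; rewrite /B addrC -lerBlDr.
  by apply: le_trans h; rewrite distrC lerB_dist.
apply: filterS nB => y yB k a.
apply: (le_trans (ler_norm_sum _ _ _)).
apply: (@le_trans _ _ (\sum_i \sum_j B k i j * `|a| ^+ 2)).
  apply: ler_sum => i _; apply: (le_trans (ler_norm_sum _ _ _)).
  apply: ler_sum => j _.
  move: (yB (k, i, j)) => /=; move: (christoffel c y k i j) => X XB.
  rewrite !normrM -mulrA expr2; apply: ler_pM => //.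
  by apply: ler_pM => //; exact: coord_le_norm.
under eq_bigr do rewrite -mulr_suml.
rewrite -mulr_suml ler_wpM2r// [leRHS](bigD1 k)//= lerDl.
by do 3!(apply: sumr_ge0 => ? _).
Qed.

(** Continuation argument: on any interval [0, s], s <= 1, where the curve stays in
    the chart, within rho of the center, with speed at most 2 eps, the geodesic
    equation bounds the acceleration by 4 K eps^2 <= eps / 2. Hence the position
    moves by at most 2 eps < rho and the speed is at most 3 eps / 2, so these
    bounds hold with room to spare and propagate a little further. *)
Lemma short_geodesic {R : realType} {n : nat} {M : riemannianManifold R n}
    (c : chart R n M) (x : M) (g : R -> M) (v : 'rV[R]_n) (K rho eps : R) :
  atlas c -> dom c x -> 0 <= K -> 0 < eps -> 2 * eps < rho -> 8 * K * eps <= 1 ->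
  (forall y, `|y - phi c x| <= rho -> (phi c @` dom c) y /\
    forall k (a : 'rV[R]_n),
      `|\sum_i \sum_j christoffel c y k i j * a 0 i * a 0 j| <= K * `|a| ^+ 2) ->
  geodesic g -> g 0 = x -> derive1 (phi c \o g) 0 = v -> `|v| <= eps ->
  dom c (g 1) /\ `|phi c (g 1) - phi c x - v| <= 4 * K * eps ^+ 2.
Proof.
move=> ac cx K0 e0 er Ke ball_rho [gcont gode] g0 gv ve.
pose u := phi c \o g; pose p := phi c x.
have u0 : u 0 = p by rewrite /u/= g0.
pose Good s := [/\ dom c (g s), `|u s - p| <= rho & `|derive1 u s| <= 2 * eps].
have du t : dom c (g t) -> derivable u t 1.
  by move=> dt; have [nd _ _] := gode c t ac dt; exact: nbhs_singleton nd.
have ddu t : dom c (g t) -> derivable (derive1 u) t 1.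
  by move=> dt; have [_ d2 _] := gode c t ac dt.
have acc t : Good t -> `|derive1 (derive1 u) t| <= 4 * K * eps ^+ 2.
  move=> [/(gode _ _ ac)[_ _ ode] /ball_rho[_ /= chr] u't].
  have L0 : 0 <= 4 * K * eps ^+ 2 by rewrite !mulr_ge0// ltW.
  apply: norm_le_coord => // k.
  have -> : derive1 (derive1 u) t 0 k = - \sum_i \sum_j
      christoffel c (u t) k i j * derive1 u t 0 i * derive1 u t 0 j.
    by apply/eqP; rewrite -addr_eq0; apply/eqP; exact: ode.
  rewrite normrN; apply: (le_trans (chr k (derive1 u t))).
  rewrite [4 * K]mulrC -mulrA ler_wpM2l//.
  rewrite (_ : 4 * eps ^+ 2 = (2 * eps) ^+ 2); last by ring.
  by apply: lerXn2r => //; rewrite nnegrE// mulr_ge0// ltW.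
have vel s : 0 <= s <= 1 -> (forall t, 0 <= t <= s -> Good t) ->
    `|derive1 u s - v| <= 4 * K * eps ^+ 2.
  move=> /andP[s0 s1] gs.
  have := mean_value_le (derive1 u) 0 (4 * K * eps ^+ 2) s s0.
  rewrite gv scaler0 subr0 => H.
  apply: (le_trans (H _)) => [t ts|].
    by rewrite subr0; split; [apply: ddu; have [] := gs t ts|exact/acc/gs].
  by rewrite ler_piMr// !mulr_ge0// ltW.
have strict s : 0 <= s <= 1 -> (forall t, 0 <= t <= s -> Good t) ->
    [/\ dom c (g s), `|u s - p| <= 2 * eps & `|derive1 u s| <= 3 / 2 * eps].
  move=> s01 gs; have /andP[s0 s1] := s01; split.
  - by have [] := gs s; rewrite ?s0/=.
  - have := mean_value_le u 0 (2 * eps) s s0; rewrite u0 scaler0 subr0 => H.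
    apply: (le_trans (H _)) => [t ts|].
      by rewrite subr0; have [? _ ?] := gs t ts; split => //; exact: du.
    by rewrite ler_piMr// mulr_ge0// ltW.
  - rewrite -[derive1 u s](subrK v) (le_trans (ler_normD _ _))//.
    have := vel s s01 gs.
    have : 4 * K * eps ^+ 2 <= eps / 2.
      rewrite (_ : 4 * K * eps ^+ 2 = 8 * K * eps * (eps / 2)); last by field.
      by rewrite ler_piMl// divr_ge0// ltW.
    by move: ve; lra.
have cont_u t : dom c (g t) -> {for t, continuous u}.
  by move=> /du/derivable1_diffP/differentiable_continuous.
have cont_u' t : dom c (g t) -> {for t, continuous (derive1 u)}.
  by move=> /ddu/derivable1_diffP/differentiable_continuous.
have rho0 : 0 < rho by lra.
pose C : set M := psi c @` [set y | `|y - p| <= rho].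
(* The curve cannot leave the chart at the limit time: C is closed in M, being
   compact in a Hausdorff space, and lies in the domain of c. *)
have closedC : closed C.
  apply: compact_closed; first exact: manifold_hausdorff.
  apply: continuous_compact.
    apply: continuous_in_subspaceT => y; rewrite inE/= => /ball_rho[cy _].
    exact: psi_continuous.
  have -> : [set y | `|y - p| <= rho] = closed_ball_ Num.Def.normr p rho.
    by apply/seteqP; split => y /=; rewrite /closed_ball_/= distrC.
  apply: bounded_closed_compact; last exact: closed_closed_ball_.
  exists (`|p| + rho); split; first exact: num_real.
  move=> z zr y; rewrite /closed_ball_/= => yp.
  rewrite -[y](subrK p) (le_trans (ler_normD _ _))// distrC.
  by move: yp zr; lra.
have good s : 0 <= s <= 1 -> Good s.
  apply: real_induction.
  - rewrite /Good u0 subrr normr0 g0 gv; split => //; first exact: ltW.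
    by move: ve; lra.
  - move=> t t01 gt; have [dt ut u't] := strict t t01 gt.
    have n1 : \forall s \near t, dom c (g s).
      by apply: gcont; apply: open_nbhs_nbhs; split => //; exact: dom_open.
    have n2 : \forall s \near t, `|u t - u s| <= rho - 2 * eps.
      by apply: continuous_near_dist; [exact: cont_u|lra].
    have n3 : \forall s \near t, `|derive1 u t - derive1 u s| <= eps / 2.
      by apply: continuous_near_dist; [exact: cont_u'|lra].
    apply: filterS3 n1 n2 n3 => r dr ur u'r; split => //.
    + rewrite (_ : u r - p = (u t - p) - (u t - u r)); last first.
        by rewrite opprB [RHS]addrC addrA subrK.
      by rewrite (le_trans (ler_normB _ _))//; move: ut ur; lra.
    + rewrite -[derive1 u r](subKr (derive1 u t)) (le_trans (ler_normB _ _))//.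
      by move: u't u'r; lra.
  - move=> t /andP[t0 t1] gt.
    have Ct : C (g t).
      apply: contrapT => nC.
      have : \forall s \near t, (~` C) (g s).
        by apply: gcont; apply: open_nbhs_nbhs; split => //; exact: closed_openC.
      move=> /(near_left_witness _ _ t0)[r rt]; apply.
      by have [dr ur _] := gt r rt; exists (u r) => //; rewrite /u/= psiK.
    have [y yr yg] := Ct.
    have [[z cz zy] _] := ball_rho _ yr.
    have zg : z = g t by rewrite -yg -zy psiK.
    have dt : dom c (g t) by rewrite -zg.
    split => //; first by rewrite /u/= -zg zy.
    rewrite leNgt; apply/negP => big.
    have : \forall s \near t, `|derive1 u t - derive1 u s| <= (`|derive1 u t| - 2 * eps) / 2.
      by apply: continuous_near_dist; [exact: cont_u'|lra].
    move=> /(near_left_witness _ _ t0)[r rt] close.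
    have [_ _ u'r] := gt r rt.
    have := ler_normD (derive1 u t - derive1 u r) (derive1 u r); rewrite subrK.
    move=> /le_trans/(_ (lerD close u'r)).
    by move: `|derive1 u t| big => N; clear; lra.
split; first by have [] := good 1; rewrite ?ler01 ?lexx.
have := mean_value_le u v (4 * K * eps ^+ 2) 1 ler01.
rewrite u0 scale1r mulr1; apply => t t01.
split; first by apply: du; have [] := good t t01.
apply: vel => // r /andP[r0 rt]; apply: good; rewrite r0 (le_trans rt)//.
by case/andP: t01.
Qed.

(** Geodesics with small initial velocity w stay in the chart up to time 1, and
    [short_geodesic] with eps = |w| describes their end point. This is the
    statement that exp_x has the identity as its derivative at 0, with a quadratic
    remainder. *)
Lemma exp_map_expansion {R : realType} {n : nat} {M : riemannianManifold R n}
    (M_complete : geodesically_complete M) (x : M) :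
  exists K delta : R, [/\ 0 <= K, 0 < delta & forall w : tangent x, `|w| <= delta ->
    dom (chart_at x) (exp_map x w) /\
    `|phi (chart_at x) (exp_map x w) - phi (chart_at x) x - (w : 'rV[R]_n)|
      <= K * `|w| ^+ 2].
Proof.
set c := chart_at x; have ac : atlas c := atlas_chart_at x.
have cx : dom c x := dom_chart_at x.
pose p := phi c x; have cp : (phi c @` dom c) p by exists x.
have [K K0 nK] := christoffel_locally_bounded c p ac cp.
have ncod : nbhs p (phi c @` dom c).
  by apply: open_nbhs_nbhs; split => //; exact: cod_open.
have FF : Filter (nbhs p) := nbhs_filter p.
have [r /= r0 rP] := (nbhs_ballP _ _).1 (filterI ncod nK).
have ball_rho y : `|y - p| <= r / 2 -> (phi c @` dom c) y /\
    forall k (a : 'rV[R]_n),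
      `|\sum_i \sum_j christoffel c y k i j * a 0 i * a 0 j| <= K * `|a| ^+ 2.
  by move=> yp; apply: rP; rewrite -ball_normE/= distrC; lra.
(* For eps <= delta: 2 eps < r / 2 and 8 K eps <= 1. *)
pose delta := Num.min (r / 8) (8 * K + 1)^-1.
have K1 : 0 < 8 * K + 1 by lra.
have d0 : 0 < delta by rewrite lt_min invr_gt0 K1 divr_gt0.
have short w eps : `|w| <= eps -> 0 < eps -> eps <= delta ->
    dom c (exp_map x w) /\ `|phi c (exp_map x w) - p - w| <= 4 * K * eps ^+ 2.
  move=> we e0; rewrite le_min => /andP[er eK].
  have [g [gg g0 gv] ->] : [set y | exists2 g, geodesic_from x w g & y = g 1]
      (exp_map x w).
    apply: xgetPex; have [g gw] := M_complete x w; exists (g 1).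
    by exists g.
  apply: (short_geodesic c x g w K (r / 2) eps ac cx) => //; first lra.
  have : (8 * K + 1) * eps <= 1 by rewrite -ler_pdivlMl// mulr1.
  by lra.
exists (4 * K), delta; split => //; first lra.
move=> w wd; have [w0|wn0] := eqVneq (`|w|) 0; last first.
  by apply: short => //; rewrite lt_def wn0 normr_ge0.
(* For w = 0 the estimate holds with every small positive eps. *)
have [dw _] := short w delta wd d0 (lexx _); split => //.
rewrite w0 expr0n mulr0; apply/ler_addgt0Pl => e e0; rewrite addr0.
pose eps := Num.min delta (e / (4 * K * delta + 1)).
have Kd : 0 < 4 * K * delta + 1.
  by apply: ltr_wpDl => //; rewrite !mulr_ge0// ltW.
have eps0 : 0 < eps by rewrite lt_min d0 divr_gt0.
have epsd : eps <= delta by rewrite ge_min lexx.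
have [|_] := short w eps _ eps0 epsd; first by rewrite w0 ltW.
move=> /le_trans; apply.
have h1 : eps * (4 * K * delta + 1) <= e.
  by rewrite -ler_pdivlMr// ge_min lexx orbT.
have h2 : 4 * K * eps * eps <= 4 * K * eps * delta.
  by apply: ler_wpM2l => //; rewrite !mulr_ge0// ltW.
by rewrite expr2; move: h1 h2 eps0; lra.
Qed.

(** * Transition maps and curves in a hypersurface *)

Lemma near_eq_continuous {V W : topologicalType} (f g : V -> W) (p : V) :
  (\forall y \near p, f y = g y) -> {for p, continuous g} -> {for p, continuous f}.
Proof.
move=> fg gp; rewrite /prop_for /continuous_at (nbhs_singleton fg).
apply: cvg_trans gp; apply: near_eq_cvg.
by apply: filterS fg => y ->.
Qed.

Lemma derive_left_inverse {R : realType} {V W : normedModType R}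
    (f : V -> W) (e : W -> V) (p w : V) :
  differentiable f p -> differentiable e (f p) -> (\forall z \near p, e (f z) = z) ->
  'D_('D_w f p) e (f p) = w.
Proof.
move=> df de ef; rewrite (deriveE _ de) (deriveE _ df).
have -> : 'd e (f p) ('d f p w) = 'D_w (e \o f) p.
  rewrite (deriveE _ (differentiable_comp df de)).
  by have -> := diff_comp df de.
by rewrite -[RHS](derive_id p w); exact: near_eq_derive.
Qed.

Lemma derive_real_direction {R : realType} {V : normedModType R} (u : R -> V)
    (t v : R) : derivable u t 1 -> 'D_v u t = v *: 'D_1 u t.
Proof.
move=> du; have dfu : differentiable u t by apply/derivable1_diffP.
by rewrite (deriveE _ dfu) diff1E// derive1E.
Qed.

Lemma chart_image_nbhs {R : realType} {n : nat} {M : topologicalType}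
    (c : chart R n M) (x : M) (U : set M) : dom c x -> nbhs x U ->
  nbhs (phi c x) (phi c @` (dom c `&` U)).
Proof.
move=> cx xU; have cp : (phi c @` dom c) (phi c x) by exists x.
have psix : psi c (phi c x) = x by rewrite psiK.
have n1 : nbhs (phi c x) (phi c @` dom c).
  by apply: open_nbhs_nbhs; split => //; exact: cod_open.
have n2 : \forall z \near phi c x, U (psi c z).
  by apply: (psi_continuous cp); rewrite psix.
apply: filterS2 n1 n2 => z [y cy <-]; rewrite psiK// => Uy.
by exists y.
Qed.

(** The hypotheses on l and L express linearity. If l w0 != 0, every w differs from
    (l w / l w0) w0 by an element of the kernel of l. *)
Lemma kernel_factor {R : realType} {V : lmodType R} (l L : V -> R) :
  (forall a u w, l (a *: u + w) = a * l u + l w) ->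
  (forall a u w, L (a *: u + w) = a * L u + L w) ->
  (forall w, l w = 0 -> L w = 0) -> exists lam : R, forall w, L w = lam * l w.
Proof.
move=> Hl HL ker.
have [[w0 lw0]|lz] := pselect (exists w0, l w0 != 0); last first.
  exists 0 => w; rewrite mul0r; apply: ker; apply/eqP; apply: contrapT => /negP lw.
  by apply: lz; exists w.
exists (L w0 / l w0) => w.
have : L (- (l w / l w0) *: w0 + w) = 0 by apply: ker; rewrite Hl; field.
by rewrite HL => /eqP; rewrite addrC addr_eq0 => /eqP ->; field.
Qed.

Section curves.
Context {R : realType} {n : nat} {M : riemannianManifold R n}.
Implicit Types (x : M) (W : set M).

Lemma transition_derivative (c d : chart R n M) x (w : 'rV[R]_n) :
  compatible 1 c d -> dom c x -> dom d x ->
  'D_('D_w (phi d \o psi c) (phi c x)) (phi c \o psi d) (phi d x) = w.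
Proof.
move=> [[df _] [de _]] cx dx.
set f := phi d \o psi c in df *; set e := phi c \o psi d in de *.
have fx : f (phi c x) = phi d x by rewrite /f/= psiK.
rewrite -{1}fx; apply: derive_left_inverse.
- by apply: df; exists x.
- by rewrite fx; apply: de; exists x.
have : nbhs (phi c x) (phi c @` (dom c `&` dom d)).
  apply: chart_image_nbhs => //; apply: open_nbhs_nbhs; split => //.
  exact: dom_open.
apply: filterS => z [y [cy dy] <-].
by rewrite /e /f /= psiK// psiK.
Qed.

(** With a the image of w under the transition map to the slice chart d, the line
    q + t a stays in the slice since a_0 = 0. Its image under psi d is a curve in W
    whose velocity is the image of a under the inverse transition, that is w. *)
Lemma kernel_in_tangent_space W (d : chart R n M) x (w : tangent x) :
  compatible 2 (chart_at x) d -> dom d x -> W x ->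
  (forall y, dom d y -> (W y <-> forall i : 'I_n, (i < 1)%N -> phi d y 0 i = 0)) ->
  (forall i : 'I_n, (i < 1)%N ->
    'D_w (phi d \o psi (chart_at x)) (phi (chart_at x) x) 0 i = 0) ->
  tangent_space_of W x w.
Proof.
move=> cd dx Wx slice aw; set c := chart_at x in cd aw *.
have cx : dom c x := dom_chart_at x.
set a := 'D_w _ _ in aw; set q := phi d x.
pose e := phi c \o psi d.
have Cke : Ck 2 (phi d @` (dom c `&` dom d)) e by case: cd.
have [de d2e] := Cke; have [dde _] := d2e a.
have wE : 'D_a e q = w.
  apply: transition_derivative => //; case: cd => -[f1 f2] [e1 e2].
  split; (split; first by []) => v y yA.
    by have [/(_ y yA)/differentiable_continuous] := f2 v.
  by have [/(_ y yA)/differentiable_continuous] := e2 v.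
have qA : nbhs q (phi d @` (dom c `&` dom d)).
  rewrite setIC; apply: chart_image_nbhs => //; apply: open_nbhs_nbhs; split => //.
  exact: dom_open.
(* Only for t near 0 does the line stay in the image of the chart. *)
have line : {for 0, continuous (fun t : R => q + t *: a)}.
  apply: differentiable_continuous; apply/derivable1_diffP.
  by case: (is_derive_line id q a 0 (@derivable_id _ _ _ _)).
have nline : \forall t \near (0 : R), (phi d @` (dom c `&` dom d)) (q + t *: a).
  by apply: line; rewrite scale0r addr0.
have [r /= r0 rP] := (nbhs_ballP _ _).1 nline.
exists (fun t => psi d (q + t *: a)); exists r => //.
have du (t : R) : ball (0 : R) r t ->
    is_derive t 1 (phi c \o (fun t => psi d (q + t *: a))) ('D_a e (q + t *: a)).
  move=> rt; apply: (is_derive_line e q a t); apply: diff_derivable.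
  by apply: de; exact: rP.
split.
- by rewrite scale0r addr0 psiK.
- move=> t /rP[y [cy dy] yE]; rewrite -yE psiK//; split => //.
  apply/(slice y dy) => i i0; rewrite yE !mxE aw// mulr0 addr0.
  exact: (slice x dx).1.
- split=> [t rt|v t rt].
    by apply/derivable1_diffP; case: (du t rt).
  apply: (@near_eq_continuous _ _ _ (fun s : R => v *: 'D_a e (q + s *: a))).
    have : nbhs t (ball (0 : R) r).
      by apply: open_nbhs_nbhs; split => //; exact: ball_open.
    apply: filterS => s rs; have ds := du s rs.
    have [dus <-] := ds; exact: derive_real_direction.
  apply: differentiable_continuous; apply: differentiableZ.
  apply/derivable1_diffP.
  have dd : derivable ('D_a e) (q + t *: a) a.
    by apply: diff_derivable; apply: dde; exact: rP.
  by case: (is_derive_line ('D_a e) q a t dd).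
- have d0 := du 0 (ballxx _ r0); rewrite /velocity derive1E derive_val.
  by rewrite scale0r addr0.
Qed.

End curves.

(** * The two inclusions *)

Section proximal.
Context {R : realType} {n : nat} {M : riemannianManifold R n}.
Context (M_complete : geodesically_complete M).
Implicit Types (x : M) (W : set M).

Lemma innerZD x (v : tangent x) (a : R) (u w : tangent x) :
  inner v (a *: u + w) = a * inner v u + inner v w.
Proof. by rewrite /inner linearP mulmxDr -scalemxAr !mxE. Qed.

Lemma inner_bound x :
  exists2 B : R, 0 <= B & forall v w : tangent x, `|inner v w| <= B * `|v| * `|w|.
Proof. exact: form_bound. Qed.

Lemma tnorm_sq x (w : tangent x) : tnorm w ^+ 2 = inner w w.
Proof.
rewrite /tnorm sqr_sqrtr// /inner.
have [->|w0] := eqVneq (w : 'rV[R]_n) 0; first by rewrite !mul0mx mxE.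
apply/ltW/gram_pos => //; first exact: atlas_chart_at.
by exists x => //; exact: dom_chart_at.
Qed.

Lemma norm_le_tnorm x :
  exists2 C : R, 0 < C & forall w : tangent x, `|w| ^+ 2 <= C * tnorm w ^+ 2.
Proof.
have cx : (phi (chart_at x) @` dom (chart_at x)) (phi (chart_at x) x).
  by exists x => //; exact: dom_chart_at.
have [C C0 CP] := @posdef_norm_le R n (gram (chart_at x) (phi (chart_at x) x))
  (gram_sym (atlas_chart_at x) cx) (fun v => gram_pos (atlas_chart_at x) cx).
by exists C => // w; rewrite tnorm_sq; exact: CP.
Qed.

Lemma exp_map0 x : exp_map x (0 : tangent x) = x.
Proof.
have [K [delta [K0 d0 E]]] := exp_map_expansion M_complete x.
have [|d1] := E (0 : tangent x); first by rewrite normr0 ltW.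
rewrite normr0 expr0n mulr0 subr0 normr_le0 subr_eq0 => /eqP pE.
by rewrite -(psiK d1) pE psiK//; exact: dom_chart_at.
Qed.

Lemma exp_invP x (V : set (tangent x)) (U : set M) y :
  normal_neighborhood x V U -> U y ->
  V (exp_inv x V y) /\ exp_map x (exp_inv x V y) = y.
Proof.
move=> [[_ _ _ [_ _ surj]] _] /surj[w Vw wy].
apply: (@xgetPex _ 0 [set w | V w /\ exp_map x w = y]).
by exists w.
Qed.

Lemma exp_inv_center x (V : set (tangent x)) (U : set M) :
  normal_neighborhood x V U -> U x /\ exp_inv x V x = 0.
Proof.
move=> nV; have [[_ V0 _ [fV inj _]] _] := nV.
have Ux : U x by rewrite -[x]exp_map0; exact: fV.
split => //; have [Vx xE] := exp_invP x V U x nV Ux.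
by apply: inj; rewrite ?inE// exp_map0.
Qed.

(** For small w the second-order contact of W with the kernel of Dh(p) gives
    sigma; for |w| >= del, |w| <= |w|^2 / del. Here f is the transition map and
    l = Dh(p), with h the coordinate of f that vanishes on W. *)
Lemma normal_sub_proximal W x (V : set (tangent x)) (U : set M) :
  submanifold 2 1 W -> W x -> normal_neighborhood x V U ->
  normal_space_of W x `<=` proximal_normal_cone W x V U.
Proof.
move=> subW Wx nV v vN.
have [d [dx compat n1 slice]] := subW x Wx.
set c := chart_at x; have ac : atlas c := atlas_chart_at x.
have cx : dom c x := dom_chart_at x.
pose p : 'rV[R]_n := phi c x; pose f : 'rV[R]_n -> 'rV[R]_n := phi d \o psi c.
pose i0 : 'I_n := Ordinal n1.
have Ckf : Ck 2 (phi c @` (dom c `&` dom d)) f by case: (compat c ac).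
have nA : nbhs p (phi c @` (dom c `&` dom d)).
  apply: chart_image_nbhs => //; apply: open_nbhs_nbhs; split => //.
  exact: dom_open.
have dfp : differentiable f p by apply: Ckf.1; exact: nbhs_singleton nA.
pose l (w : 'rV[R]_n) : R := 'D_w f p 0 i0.
have lE w : l w = 'd f p w 0 i0 by rewrite /l deriveE.
have lZD a u w : l (a *: u + w) = a * l u + l w.
  by rewrite !lE linearP !mxE.
have i0E (i : 'I_n) : (i < 1)%N -> i = i0.
  by move=> i1; apply: val_inj; rewrite /=; case: (nat_of_ord i) i1.
have [lam lamE] : exists lam : R, forall w : 'rV[R]_n, inner v (w : tangent x) = lam * l w.
  apply: kernel_factor => //; first exact: innerZD.
  move=> w lw; apply: vN; apply: (kernel_in_tangent_space W d) => //.
    exact: compat.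
  by move=> i /i0E ->.
have [C C0 taylor] := taylor2 f _ p nA Ckf.
have [k k0 kP] := linear_lipschitz (diff_continuous dfp).
have [K [delta [K0 d0 E]]] := exp_map_expansion M_complete x.
have [B B0 BP] := inner_bound x.
have [C1 C10 C1P] := norm_le_tnorm x.
have [[_ V0 _ _] [contE _ _]] := nV.
have nd : \forall w \near (0 : tangent x), dom d (exp_map x w).
  apply: (contE 0 V0); rewrite exp_map0; apply: open_nbhs_nbhs; split => //.
  exact: dom_open.
have [r1 /= r10 r1P] := (nbhs_ballP _ _).1 taylor.
have [r2 /= r20 r2P] := (nbhs_ballP _ _).1 nd.
have K1 : 0 < 1 + K by lra.
pose del := Num.min (Num.min delta 1) (Num.min (r1 / (1 + K)) r2).
have del0 : 0 < del by rewrite !lt_min d0 ltr01 divr_gt0.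
(* C |h|^2 from Taylor's formula, where |h| <= (1 + K) |w|, and k |h - w| from
   replacing the increment h of the coordinates by w. *)
pose D := C * (1 + K) ^+ 2 + k * K.
have D0 : 0 <= D by rewrite addr_ge0 ?mulr_ge0 ?exprn_ge0 ?(ltW K1) ?(ltW k0).
have small w : `|w| < del -> W (exp_map x w) -> inner v w <= `|lam| * D * `|w| ^+ 2.
  rewrite !lt_min => /andP[/andP[wd w1] /andP[wr1 wr2]] Ww.
  have [cw Ew] := E w (ltW wd).
  have dw : dom d (exp_map x w).
    by apply: r2P; rewrite -ball_normE/= sub0r normrN.
  rewrite -/c -/p in cw Ew.
  pose h : 'rV[R]_n := phi c (exp_map x w) - p.
  have hw : `|h| <= (1 + K) * `|w|.
    rewrite -[h](subrK (w : 'rV[R]_n)) (le_trans (ler_normD _ _))// mulrDl mul1r addrC lerD2l.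
    by rewrite (le_trans Ew)// expr2 mulrA ler_piMr ?mulr_ge0// ltW.
  have hr : ball (0 : 'rV[R]_n) r1 h.
    rewrite -ball_normE/= sub0r normrN (le_lt_trans hw)//.
    by rewrite mulrC -ltr_pdivlMr.
  have ph : p + h = phi c (exp_map x w) by rewrite /h addrC subrK.
  have := r1P h hr; rewrite ph.
  have f0 : f p 0 i0 = 0 by rewrite /f/= psiK//; exact: (slice x dx).1.
  have fw : f (phi c (exp_map x w)) 0 i0 = 0.
    by rewrite /f/= psiK//; exact: (slice _ dw).1.
  move=> /(le_trans (coord_le_norm _ 0 i0)).
  rewrite !mxE fw f0 subr0 sub0r normrN -/(l h) => lh.
  have lhw : `|l (h - w)| <= k * (K * `|w| ^+ 2).
    rewrite lE (le_trans (coord_le_norm _ _ _))// (le_trans (kP _))//.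
    by rewrite ler_wpM2l// ltW.
  have lwE : l w = l h - l (h - w).
    have -> : h - w = (-1) *: (w : 'rV[R]_n) + h by rewrite scaleN1r addrC.
    by rewrite lZD mulN1r opprD opprK addrC subrK.
  have lw : `|l w| <= D * `|w| ^+ 2.
    rewrite lwE (le_trans (ler_normB _ _))// /D mulrDl -[k * K * _]mulrA lerD//.
    apply: (le_trans lh); rewrite -mulrA ler_wpM2l// -exprMn.
    by apply: lerXn2r => //; rewrite nnegrE// mulr_ge0// ltW.
  rewrite lamE (le_trans (ler_norm _))// normrM -mulrA ler_wpM2l//.
pose S := `|lam| * D + B * `|v| / del.
have S0 : 0 <= S by rewrite addr_ge0// ?mulr_ge0// invr_ge0 ltW.
exists (S * C1); first by rewrite mulr_ge0// ltW.
move=> y Uy Wy; have [Vw wy] := exp_invP x V U y nV Uy.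
set w := exp_inv x V y in Vw wy *.
apply: (@le_trans _ _ (S * `|w| ^+ 2)); last first.
  by rewrite -mulrA ler_wpM2l.
have w2 : 0 <= `|w| ^+ 2 by rewrite exprn_ge0.
have [wd|wd] := ltP `|w| del.
  apply: (le_trans (small w wd _)); first by rewrite wy.
  by rewrite ler_wpM2r// lerDl mulr_ge0 ?invr_ge0 ?mulr_ge0// ltW.
apply: (le_trans (ler_norm _)); apply: (le_trans (BP v w)).
apply: (@le_trans _ _ (B * `|v| / del * `|w| ^+ 2)); last first.
  by rewrite ler_wpM2r// lerDr mulr_ge0.
rewrite -!mulrA ler_wpM2l// ler_wpM2l// expr2 mulrA ler_peMl//.
by rewrite mulrC ler_pdivlMr// mul1r.
Qed.

(** The curve is compared with om(t) = exp_x^{-1}(g(t)), which tends to 0 because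
    exp_x^{-1} is continuous at x. The expansion of exp_x then gives
    u(t) - p = om(t) + O(|om(t)|^2), which forces |om(t)| = O(|t|), and the
    proximal inequality for om(t) turns into <v, u(t) - p> <= D t^2. A function
    with derivative iota and value 0 at 0 can be bounded by D t^2 on both sides
    of 0 only if iota = 0. *)
Lemma proximal_sub_normal W x (V : set (tangent x)) (U : set M) :
  normal_neighborhood x V U ->
  proximal_normal_cone W x V U `<=` normal_space_of W x.
Proof.
move=> nV v [sigma s0 vP] w [g [e e0 [g0 gW Cku gv]]].
set c := chart_at x in gW Cku gv; have ac : atlas c := atlas_chart_at x.
have cx : dom c x := dom_chart_at x.
pose p : 'rV[R]_n := phi c x; pose u : R -> 'rV[R]_n := phi c \o g.
have u0 : u 0 = p by rewrite /u/= g0.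
have [du _] := Cku.
have du0 : differentiable u 0 by apply: du; exact: ballxx.
have d1 : 'd u 0 = (fun h : R => h *: (w : 'rV[R]_n)) :> (R -> 'rV[R]_n).
  by rewrite diff1E// -gv.
have [Ux F0] := exp_inv_center x V U nV.
have [[_ V0 oU _] [_ _ smF]] := nV.
have contF : {for p, continuous (exp_inv x V \o psi c)}.
  by apply: (smF c ac 0); exists x.
have cu : {for 0, continuous u} by exact: differentiable_continuous.
have nW : \forall t \near (0 : R), W (g t) /\ dom c (g t).
  apply: filterS (nbhsx_ballx (0 : R) e e0) => t; exact: gW.
have nU : \forall t \near (0 : R), U (psi c (u t)).
  have : \forall z \near p, U (psi c z).
    apply: psi_continuous; first by exists x.
    by rewrite /p psiK//; exact: open_nbhs_nbhs.
  by rewrite -u0 => /cu.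
have [K [delta [K0 d0 E]]] := exp_map_expansion M_complete x.
have [B B0 BP] := inner_bound x.
have [C C0 lip] := differentiable_lipschitz_at u 0 du0.
(* |om| <= m makes the remainder K |om|^2 of the expansion at most |om| / 2. *)
pose m := Num.min delta (2 * K + 1)^-1.
have K1 : 0 < 2 * K + 1 by lra.
have m0 : 0 < m by rewrite lt_min d0 invr_gt0.
have nF : \forall t \near (0 : R), `|exp_inv x V (psi c (u t))| <= m.
  have : \forall z \near p, `|exp_inv x V (psi c z)| <= m.
    have := continuous_near_dist _ _ _ contF m0.
    by apply: filterS => z /=; rewrite /p psiK// F0 sub0r normrN.
  by rewrite -u0 => /cu.
pose D := 4 * sigma * B * C ^+ 2 + 4 * B * `|v| * K * C ^+ 2.
have bound : \forall t \near (0 : R), inner v (u t - p : tangent x) <= D * t ^+ 2.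
  have FF : Filter (nbhs (0 : R)) := nbhs_filter (0 : R).
  apply: filterS (filterI nW (filterI nU (filterI lip nF))) => t [[Wt ct] [Ut [ut Ft]]].
  have gt : psi c (u t) = g t by rewrite /u/= psiK.
  rewrite gt in Ut Ft; have [_ omE] := exp_invP x V U (g t) nV Ut.
  have := vP (g t) Ut Wt; set om := exp_inv x V (g t) in Ft omE *.
  move=> vom; move: Ft; rewrite le_min => /andP[omd omK].
  rewrite add0r u0 in ut.
  have [_] := E om omd; rewrite omE -/c -/p -[phi c (g t)]/(u t) => Et.
  have omK' : K * `|om| ^+ 2 <= `|om| / 2.
    rewrite expr2 mulrA mulrC ler_wpM2l//.
    have : (2 * K + 1) * `|om| <= 1 by rewrite -ler_pdivlMl// mulr1.
    by have := normr_ge0 om; lra.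
  have om2 : `|om| <= 2 * C * `|t|.
    have := ler_normB (u t - p) (u t - p - (om : 'rV[R]_n)); rewrite subKr.
    by move: Et omK' ut; lra.
  have omsq : `|om| ^+ 2 <= 4 * C ^+ 2 * t ^+ 2.
    rewrite -(real_normK (num_real t)).
    rewrite (_ : 4 * C ^+ 2 * `|t| ^+ 2 = (2 * C * `|t|) ^+ 2); last by ring.
    by apply: lerXn2r => //; rewrite nnegrE// !mulr_ge0.
  have -> : inner v (u t - p : tangent x) =
      inner v om + inner v (u t - p - (om : 'rV[R]_n) : tangent x).
    by rewrite -[X in _ = X + _]mul1r -innerZD scale1r [X in _ = inner v X]addrC subrK.
  rewrite /D mulrDl; apply: lerD.
    apply: (le_trans vom); rewrite tnorm_sq.
    apply: (@le_trans _ _ (sigma * (B * `|om| ^+ 2))).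
      by rewrite ler_wpM2l// (le_trans (ler_norm _))// (le_trans (BP _ _))// expr2 mulrA.
    rewrite (_ : 4 * sigma * B * C ^+ 2 * t ^+ 2 = sigma * (B * (4 * C ^+ 2 * t ^+ 2))); last by ring.
    by rewrite !ler_wpM2l.
  apply: (le_trans (ler_norm _)); apply: (le_trans (BP _ _)).
  rewrite (_ : 4 * B * `|v| * K * C ^+ 2 * t ^+ 2 = B * `|v| * (K * (4 * C ^+ 2 * t ^+ 2))); last by ring.
  rewrite ler_wpM2l ?mulr_ge0//; apply: (le_trans Et).
  by rewrite ler_wpM2l.
have D0 : 0 <= D by rewrite addr_ge0// !mulr_ge0// exprn_ge0.
apply/eqP; apply: contrapT => /negP; rewrite -normr_gt0 => iota0.
set iota := inner v w in iota0 *.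
pose E' := B * `|v|; have E0 : 0 <= E' by rewrite mulr_ge0.
have E1 : 0 < 4 * (E' + 1) by lra.
(* At t = tau or t = - tau, whichever makes t iota positive, the two error terms
   are each at most a quarter of tau |iota|. *)
pose eta := `|iota| / (4 * (E' + 1)).
have eta0 : 0 < eta by rewrite divr_gt0.
have first_order := differentiable_first_order u 0 eta du0 eta0.
have [r /= r0 rP] := (nbhs_ballP _ _).1 (filterI bound first_order).
have key t : `|t| < r -> t * iota <= D * t ^+ 2 + E' * (eta * `|t|).
  move=> tr; have [|b1 b2] := rP t; first by rewrite /ball/= sub0r normrN.
  rewrite add0r u0 d1 in b2.
  have -> : t * iota = inner v (u t - p : tangent x) -
      inner v (u t - p - t *: (w : 'rV[R]_n) : tangent x).
    have -> : (u t - p - t *: (w : 'rV[R]_n)) = (- t) *: (w : 'rV[R]_n) + (u t - p).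
      by rewrite scaleNr addrC.
    by rewrite innerZD mulNr opprD opprK addrCA subrr addr0.
  apply: lerD => //; apply: (le_trans (ler_norm _)); rewrite normrN.
  by apply: (le_trans (BP _ _)); rewrite ler_wpM2l// mulr_ge0.
have D1 : 0 < 4 * (D + 1) by lra.
pose tau := Num.min (r / 2) (`|iota| / (4 * (D + 1))).
have tau0 : 0 < tau by rewrite lt_min !divr_gt0.
have taur : tau < r by rewrite gt_min; apply/orP; left; lra.
have tauD : D * tau <= `|iota| / 4.
  have : tau * (4 * (D + 1)) <= `|iota| by rewrite -ler_pdivlMr// ge_min lexx orbT.
  by move: tau0; clear; lra.
have etaE : E' * eta <= `|iota| / 4.
  have : eta * (4 * (E' + 1)) = `|iota| by rewrite /eta divfK// gt_eqF.
  by move: eta0; clear; lra.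
have : tau * `|iota| <= D * tau ^+ 2 + E' * (eta * tau).
  have [io|io] := leP 0 iota.
    rewrite ger0_norm//; have := key tau; rewrite (gtr0_norm tau0); exact.
  rewrite ltr0_norm//; have := key (- tau).
  by rewrite normrN (gtr0_norm tau0) sqrrN mulrN mulNr; exact.
rewrite expr2 [E' * _]mulrA [D * _]mulrA -mulrDl [tau * _]mulrC ler_pM2r//.
by move: tauD etaE iota0; clear; lra.
Qed.

End proximal.

Theorem corollary2p5 (R : realType) (n : nat) (M : riemannianManifold R n)
    (W : set M) (M_complete : geodesically_complete M) (W_submanifold : submanifold 2 1 W)
    (x : M) (Wx : W x) (V : set (tangent x)) (U : set M)
    (U_normal : normal_neighborhood x V U) :
  proximal_normal_cone W x V U = normal_space_of W x.
Proof.
apply/seteqP; split.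
  exact: proximal_sub_normal.
exact: normal_sub_proximal.
Qed.
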